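(* Let $n \in \mathbb{N}$, let $a \in \mathbb{Z}$ satisfy $a \geq -n$, and set $\hat{a} := a + \max(1,-a)$. The extreme rays of the non-negative cone $P_{n,a}$ correspond to (i.e. are the rays generated by the sequences whose generating functions are) the polynomials $1, t, \dotsc, t^a$ (none if $a<0$) and the power series $$\sum_{j \geq \hat{a}} \Bigl( p_\lambda(j-\hat{a}) \prod_{\ell=1}^{\hat{a}-a-1} (j+\ell) \Bigr) t^j, \qquad \sum_{j \geq \hat{a}} \Bigl( (j-\hat{a})\, p_\mu(j-\hat{a}-1) \prod_{\ell=1}^{\hat{a}-a-1} (j+\ell) \Bigr) t^j,$$ where $\lambda$ ranges over all integer partitions with at most $\lfloor (n-\hat{a}+a)/2 \rfloor$ parts and $\mu$ ranges over all integer partitions with at most $\lfloor (n-\hat{a}+a-1)/2 \rfloor$ parts.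
   Context: $\mathbb{N}$ is the set of non-negative integers. $V_{n,a} \subset \mathbb{Q}^{\mathbb{N}}$ is the finite-dimensional $\mathbb{Q}$-subspace of all sequences $h \colon \mathbb{N} \to \mathbb{Q}$ such that $\sum_{j \in \mathbb{N}} h(j) t^j = (b_0 + b_1 t + \dotsb + b_{a+n} t^{a+n})/(1-t)^n$ for some $b_0, \dotsc, b_{a+n} \in \mathbb{Q}$; a sequence $h \in V_{n,a}$ is identified with its generating function $\sum_j h(j) t^j$. $P_{n,a}$ denotes the closed convex hull in $V_{n,a}$ (with its Euclidean topology) of $\mathbb{N}^{\mathbb{N}} \cap V_{n,a}$. For an integer partition $\lambda = (\lambda_1, \lambda_2, \dotsc, \lambda_r)$ with $\lambda_1 \geq \lambda_2 \geq \dotsb \geq \lambda_r \geq 0$ (parts equal to zero are allowed and counted, so $\lambda$ has $r$ parts; $r=0$ is the empty partition), define $$p_\lambda(s) := \prod_{i=1}^r (s - \lambda_{r-i+1} - 2i + 2)(s - \lambda_{r-i+1} - 2i + 1) \in \mathbb{Z}[s],$$ so $p_\varnothing = 1$. If an upper bound on the number of parts is negative, there are no such partitions. Empty products equal $1$. *)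

(* Defs.v *)
From HB Require Import structures.
From mathcomp Require Import all_boot all_order all_algebra.
From mathcomp Require Import all_classical topology normedtype convex.

Set Implicit Arguments.
Unset Strict Implicit.
Unset Printing Implicit Defensive.
Import Order.TTheory GRing.Theory Num.Theory.
Import numFieldNormedType.Exports.
Local Open Scope classical_set_scope.
Local Open Scope ring_scope.

(* The alias rat^o of rat carries the scalar multiplication and the usual
   absolute-value topology of the rationals. *)
Notation ratseq := (nat -> rat^o).

(* A sequence h is identified with the formal power series \sum_j h j * t ^ j;
   cauchy_prod is the product of the ring of formal power series. *)
Definition cauchy_prod (g h : ratseq) : ratseq :=
  fun k => \sum_(i < k.+1) g i * h (k - i)%N.

Definition coefs (p : {poly rat}) : ratseq := fun k => p`_k.

(* The quotient B / (1 - t) ^ n is the unique power series h such that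
   (1 - t) ^ n * h = B; the bound on the size of B says deg B <= a + n. *)
Definition V (n : nat) (a : int) : set ratseq :=
  [set h | exists2 B : {poly rat},
     (size B)%:Z <= a + n%:Z + 1 &
     cauchy_prod (coefs ((1 - 'X) ^+ n)) h = coefs B].

Definition natural_seqs : set ratseq :=
  [set h | forall j, exists m : nat, h j = m%:R].

(* Closed subsets of a finite-dimensional subspace W in its Euclidean topology,
   transported from Q^d along a linear isomorphism f : Q^d -> W. The choice of f
   is immaterial since linear automorphisms of Q^d are homeomorphisms. *)
Definition euclidean_closed (W C : set ratseq) : Prop :=
  C `<=` W /\
  exists (d : nat) (f : {linear 'rV[rat^o]_d -> ratseq}),
    set_bij [set: 'rV[rat^o]_d] W f /\ closed (f @^-1` C).

Definition closed_convex_hull (W S : set ratseq) : set ratseq :=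
  smallest (fun C : set ratseq => convex_set C /\ euclidean_closed W C) S.

Definition P (n : nat) (a : int) : set ratseq :=
  closed_convex_hull (V n a) (natural_seqs `&` V n a).

Definition ray (h : ratseq) : set ratseq :=
  [set c *: h | c in [set c : rat | 0 <= c]].

Definition extreme_ray (C R : set ratseq) : Prop :=
  [/\ exists2 h : ratseq, h <> 0 & R = ray h,
      R `<=` C &
      forall x y : ratseq, C x -> C y -> R (x + y) -> R x /\ R y].

(* Trailing zeros are allowed and significant: the number of parts is the
   size of the sequence. *)
Definition is_partition (l : seq nat) : bool := sorted geq l.

(* The part l_(r-i+1), numbered from 1, is nth 0 l (r - i), with r = size l. *)
Definition part_poly (l : seq nat) : {poly int} :=
  \prod_(1 <= i < (size l).+1)
    (('X - ((nth 0%N l (size l - i)%N)%:Z + 2 * i%:Z - 2)%:P) *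
     ('X - ((nth 0%N l (size l - i)%N)%:Z + 2 * i%:Z - 1)%:P)).

Definition hat (a : int) : int := a + Num.max 1 (- a).

(* The product over 1 <= k <= hat a - a - 1; recall hat a - a >= 1. *)
Definition shift_prod (a : int) (j : nat) : rat :=
  \prod_(1 <= k < `|hat a - a|%N) (j + k)%N%:R.

Definition monomial_seq (i : nat) : ratseq := fun j => (j == i)%:R.

Definition lambda_seq (a : int) (l : seq nat) : ratseq := fun j =>
  if hat a <= j%:Z then
    ((part_poly l).[j%:Z - hat a])%:~R * shift_prod a j
  else 0.

Definition mu_seq (a : int) (m : seq nat) : ratseq := fun j =>
  if hat a <= j%:Z then
    ((j%:Z - hat a) * (part_poly m).[j%:Z - hat a - 1])%:~R * shift_prod a j
  else 0.

(* Main.v *)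
(* Write H for \hat a. A sequence of V_{n,a} consists of H free values followed
   by the values on j >= H of q(j - H) times a fixed positive product, with q a
   polynomial of bounded degree. Clearing denominators identifies P_{n,a} with
   the set of all non-negative sequences of V_{n,a}: a product of H half-lines
   with the cone of the polynomials q that are non-negative on the natural
   numbers.
   The p_lambda and x p_mu(x - 1) are the products of linear factors over
   disjoint pairs {m, m + 1} of natural numbers, possibly together with 0. They
   span extreme rays because a summand below such a p vanishes at its (simple)
   roots and has no larger degree. Conversely, every q in the cone admits such a
   p vanishing at all natural roots of q, with deg p <= deg q: a root m of q not
   followed by the root m + 1 forces a further real root by a sign change. Then
   q - e p stays in the cone for a small e > 0, so that an extreme q is
   proportional to p. *)
Require Import Defs.
From HB Require Import structures.
From mathcomp Require Import all_boot all_order all_algebra.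
From mathcomp Require Import all_classical topology normedtype convex.
From mathcomp Require Import zify lra polyrcf realalg.

Set Implicit Arguments.
Unset Strict Implicit.
Unset Printing Implicit Defensive.
Import Order.TTheory GRing.Theory Num.Theory.
Import numFieldNormedType.Exports.
Local Open Scope classical_set_scope.
Local Open Scope ring_scope.
Import interval_inference.

(** * Root lists of the two families of polynomials *)

(** The roots of $p_\lambda$, in increasing order when [l] is a partition: the indices 2b and 2b + 1
    share one part of the reversed list, so their entries are consecutive numbers. *)
Definition pair_roots (l : seq nat) : seq nat :=
  [seq (nth 0 (rev l) i./2 + i)%N | i <- iota 0 (size l).*2].

Definition from_roots (R : nzRingType) (rs : seq nat) : {poly R} :=
  \prod_(x <- rs) ('X - (x%:R)%:P).

Lemma size_pair_roots l : size (pair_roots l) = (size l).*2.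
Proof. by rewrite size_map size_iota. Qed.

Lemma part_polyE l : part_poly l = from_roots int (pair_roots l).
Proof.
rewrite /part_poly /from_roots /pair_roots big_map.
have H (F : nat -> {poly int}) r :
  \prod_(i <- iota 0 r.*2) F i =
  \prod_(1 <= i < r.+1) (F i.-1.*2 * F i.-1.*2.+1).
  elim: r => [|r IH]; first by rewrite big_nil big_geq.
  rewrite big_nat_recr // -IH doubleS -addn2 iotaD big_cat add0n /=.
  by rewrite !big_cons big_nil mulr1.
rewrite H; apply: eq_big_nat => i /andP[i1 ir].
rewrite nth_rev; last by lia.
rewrite nth_rev; last by lia.
rewrite /= uphalf_double doubleK prednK //.
by congr (('X - _%:P) * ('X - _%:P)); lia.
Qed.

(** The reversed parts increase weakly, and the added index makes the entries increase strictly. *)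
Lemma uniq_pair_roots l : is_partition l -> uniq (pair_roots l).
Proof.
move=> pl; rewrite map_inj_in_uniq ?iota_uniq // => i j.
rewrite !mem_iota !add0n !leq0n /= => il jl eq_ij.
have pr : sorted leq (rev l) by rewrite rev_sorted.
have mono a b : (a <= b)%N -> (b < (size l).*2)%N ->
  (nth 0%N (rev l) a./2 <= nth 0%N (rev l) b./2)%N.
  move=> ab bl; apply: (sorted_leq_nth leq_trans leqnn) => //.
  - by rewrite inE size_rev; lia.
  - by rewrite inE size_rev; lia.
  - exact: half_leq.
case: (leqP i j) => [ij|/ltnW ji].
- by have := mono _ _ ij jl; lia.
- by have := mono _ _ ji il; lia.
Qed.

(** This is how a partition grows in the induction of [cover_by_pairs]: a new smallest part k puts
    the pair {k, k + 1} in front and moves all other pairs beyond it. *)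
Lemma pair_roots_rcons k l :
  pair_roots (rcons (map (addn k) l) k) =
  [:: k, k.+1 & map (addn k.+2) (pair_roots l)].
Proof.
rewrite /pair_roots size_rcons size_map doubleS -addn2 addnC iotaD map_cat /=.
rewrite rev_rcons /= addn0 addn1 -map_rev; congr [:: _, _ & _].
rewrite (iotaDl 2 0) -!map_comp; apply/eq_in_map => i.
rewrite mem_iota => /andP[_ il] /=.
by rewrite (nth_map 0%N) ?size_rev ?add0n; lia.
Qed.

Lemma is_partition_rcons k l :
  is_partition l -> is_partition (rcons (map (addn k) l) k).
Proof.
have E s : is_partition s = sorted leq (rev s) by rewrite rev_sorted.
rewrite !E rev_rcons -map_rev /= => pl.
rewrite path_sortedE; last by move=> x y z; exact: leq_trans.
apply/andP; split; first by apply/allP => x /mapP[y _ ->]; rewrite leq_addr.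
by rewrite sorted_map; apply: sub_sorted pl => x y /=; rewrite leq_add2l.
Qed.

Lemma monic_from_roots (R : nzRingType) rs : from_roots R rs \is monic.
Proof. exact: monic_prod_XsubC. Qed.

Lemma size_from_roots (R : nzRingType) rs :
  size (from_roots R rs) = (size rs).+1.
Proof. by rewrite /from_roots size_prod_XsubC. Qed.

Lemma horner_from_roots (R : comNzRingType) rs (x : R) :
  (from_roots R rs).[x] = \prod_(r <- rs) (x - r%:R).
Proof.
by rewrite horner_prod; apply: eq_bigr => i _; rewrite hornerXsubC.
Qed.

Lemma from_roots_eq0 (R : numDomainType) rs (k : nat) :
  ((from_roots R rs).[k%:R] == 0) = (k \in rs).
Proof.
rewrite horner_from_roots prodf_seq_eq0; apply/hasP/idP => [[x xs /=]|ks].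
  by rewrite subr_eq0 eqr_nat => /eqP->.
by exists k => //=; rewrite subrr.
Qed.

(** Over the integers each pair of factors has the form w (w - 1), and no integer lies strictly
    between 0 and 1. *)
Lemma from_roots_pair_ge0 l (k : nat) :
  0 <= (from_roots rat (pair_roots l)).[k%:R].
Proof.
have -> : (from_roots rat (pair_roots l)).[k%:R] =
          ((part_poly l).[k%:Z])%:~R.
  rewrite part_polyE !horner_from_roots rmorph_prod; apply: eq_bigr => i _.
  by rewrite rmorphB /= !mulrz_nat.
rewrite ler0z /part_poly horner_prod; apply: prodr_ge0 => i _.
rewrite hornerM !hornerXsubC.
move: (_ + 2 * i%:Z) => u.
have -> : k%:Z - (u - 1) = (k%:Z - (u - 2)) - 1 by lia.
move: (k%:Z - _) => w.
have [w0|w1] : w <= 0 \/ 1 <= w by lia.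
- by rewrite mulr_le0 //; lia.
- by rewrite mulr_ge0 //; lia.
Qed.

(** The roots of $x p_\mu(x - 1)$. *)
Definition odd_roots (l : seq nat) : seq nat := 0%N :: map succn (pair_roots l).

Lemma from_roots_odd_ge0 l (k : nat) :
  0 <= (from_roots rat (odd_roots l)).[k%:R].
Proof.
rewrite horner_from_roots big_cons big_map subr0.
case: k => [|k]; first by rewrite mul0r.
apply: mulr_ge0; first exact: ler0n.
have := from_roots_pair_ge0 l k; rewrite horner_from_roots.
by under [X in _ -> 0 <= X]eq_bigr do rewrite -!natr1 opprD addrACA subrr addr0.
Qed.

Lemma uniq_odd_roots l : is_partition l -> uniq (odd_roots l).
Proof.
move=> pl; rewrite /= map_inj_uniq ?uniq_pair_roots ?andbT //.
  by apply/mapP => -[].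
exact: succn_inj.
Qed.

Definition generator (rs : seq nat) : Prop :=
  exists2 l, is_partition l & rs = pair_roots l \/ rs = odd_roots l.

Lemma generator_uniq rs : generator rs -> uniq rs.
Proof.
by move=> [l pl [|] ->]; [exact: uniq_pair_roots | exact: uniq_odd_roots].
Qed.

Lemma generator_ge0 rs (k : nat) :
  generator rs -> 0 <= (from_roots rat rs).[k%:R].
Proof.
by move=> [l _ [|] ->]; [exact: from_roots_pair_ge0|exact: from_roots_odd_ge0].
Qed.

(** * Covering the natural roots of a polynomial by pairs *)

Section Covering.
Variable R : rcfType.

Lemma horner_comp_shift (p : {poly R}) (c x : R) :
  (p \Po ('X + c%:P)).[x] = p.[x + c].
Proof. by rewrite horner_comp hornerD hornerX hornerC. Qed.

Lemma size_comp_shift (p : {poly R}) (c : R) :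
  size (p \Po ('X + c%:P)) = size p.
Proof. by rewrite size_comp_poly2 // size_XaddC. Qed.

Lemma divide_root (p : {poly R}) (r : R) : root p r -> p != 0 ->
  exists2 q : {poly R}, size p = (size q).+1 & p = q * ('X - r%:P).
Proof.
move=> /factor_theorem[q ->] nz; exists q => //.
rewrite size_Mmonic ?monicXsubC ?size_XsubC ?addn2 //.
by apply: contraNneq nz => ->; rewrite mul0r.
Qed.

(* If k is the least natural root of g, the sign of g / (x - k) changes between
   y and k + 1, which yields a second root r (possibly k + 1 itself). Dividing
   by both, the situation repeats beyond the pair {k, k + 1}. *)
Lemma cover_by_pairs (g : {poly R}) (y : R) :
  y < 0 -> 0 < g.[y] -> (forall k : nat, 0 <= g.[k%:R]) ->
  exists l, [/\ is_partition l, (size (pair_roots l) < size g)%N &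
    forall k : nat, g.[k%:R] = 0 -> k \in pair_roots l].
Proof.
have [N] := ubnP (size g); elim: N => // N IH in g y *.
rewrite ltnS => sg y0 gy g0.
have nz : g != 0 by apply: contraTneq gy => ->; rewrite horner0 ltxx.
have [[k0 gk0]|nogk] := pselect (exists k : nat, g.[k%:R] == 0); last first.
  exists [::]; split=> //; first by rewrite size_poly_gt0.
  by move=> k gk; case: nogk; exists k; apply/eqP.
have [k /eqP gk kmin] := @ex_minnP (fun k : nat => g.[k%:R] == 0)
                       (ex_intro _ k0 gk0).
have [g1 sg1 Dg] := divide_root (introT rootP gk) nz.
have ky : y - k%:R < 0 by rewrite subr_lt0 (lt_le_trans y0).
have g1y : g1.[y] < 0.
  by move: gy; rewrite Dg hornerM hornerXsubC nmulr_lgt0.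
have g1k (j : nat) : (k < j)%N -> 0 <= g1.[j%:R].
  move=> kj; have := g0 j.
  by rewrite Dg hornerM hornerXsubC pmulr_lge0 // subr_gt0 ltr_nat.
have [r /andP[yr rk] rr] : exists2 r, y <= r <= k.+1%:R & root g1 r.
  by apply: poly_ivt; rewrite ?g1k ?ltW // (lt_le_trans y0).
have nz1 : g1 != 0 by apply: contraTneq g1y => ->; rewrite horner0 ltxx.
have [g2 sg2 Dg1] := divide_root rr nz1.
have {}yr : y < r.
  rewrite lt_neqAle yr andbT; apply: contraTneq g1y => ->.
  by rewrite (rootP rr) ltxx.
have g2y : 0 < g2.[y].
  by move: g1y; rewrite Dg1 hornerM hornerXsubC nmulr_llt0 // subr_lt0.
(* As r is at most k + 1, the factor x - r is positive from k + 2 on, so the second quotient keeps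
   its sign there. *)
have rj (j : nat) : 0 < (k.+2 + j)%:R - r.
  by rewrite subr_gt0 (le_lt_trans rk) // ltr_nat; lia.
have g2k (j : nat) : 0 <= g2.[(k.+2 + j)%:R].
  have := g1k (k.+2 + j)%N; rewrite Dg1 hornerM hornerXsubC pmulr_lge0 //.
  by apply; lia.
have [||||l [pl sl lP]] := IH (g2 \Po ('X + (k.+2%:R)%:P)) (y - k.+2%:R).
- by rewrite size_comp_shift; lia.
- by rewrite subr_lt0 (lt_le_trans y0).
- by rewrite horner_comp_shift subrK.
- by move=> j; rewrite horner_comp_shift -natrD addnC.
(* Two roots k and k + 1 are added while the degree has dropped by two, which keeps the size
   bound. *)
exists (rcons (map (addn k) l) k); split; first exact: is_partition_rcons.
  move: sl; rewrite pair_roots_rcons size_comp_shift /= size_map.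
  by rewrite sg1 sg2 !ltnS.
move=> j gj; rewrite pair_roots_rcons !inE.
have kj : (k <= j)%N by apply: kmin; apply/eqP.
have [->|jk] := eqVneq j k; first by [].
have [->|jk1] := eqVneq j k.+1; first by rewrite orbT.
have -> : j = (k.+2 + (j - k.+2))%N by lia.
rewrite (mem_map (@addnI _)) lP ?orbT //.
apply/eqP; rewrite horner_comp_shift -natrD addnC.
have Ej : (k.+2 + (j - k.+2))%N = j by lia.
move: gj (rj (j - k.+2)%N); rewrite Dg Dg1 !hornerM !hornerXsubC Ej.
move=> /eqP; rewrite !mulf_eq0 => /orP[/orP[//|/eqP->]|]; first by rewrite ltxx.
by rewrite subr_eq0 eqr_nat (negbTE jk).
Qed.

(** The sign of g at a negative non-root y selects the family. If it is positive, pairs suffice. If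
    it is negative, g has a root r between y and 0; dividing by x - r and shifting by 1 leads back
    to the first case, and r pays for the extra root 0 in [odd_roots]. *)
Lemma cover_natural_roots (g : {poly R}) :
  g != 0 -> (forall k : nat, 0 <= g.[k%:R]) ->
  exists rs, [/\ generator rs, (size rs < size g)%N &
    forall k : nat, g.[k%:R] = 0 -> k \in rs].
Proof.
move=> nz g0.
have [y y0 gy] : exists2 y, y < 0 & g.[y] != 0.
  (* A nonzero g has fewer roots than [size g], so one of -1, ..., -[size g] is not a root. *)
  have H : ~~ all (root g) [seq - (i.+1%:R) | i <- iota 0 (size g)].
    apply: contraL nz => /max_poly_roots H; apply/negP => /H.
    rewrite size_map size_iota ltnn => F; apply/notF/F.
    rewrite map_inj_uniq ?iota_uniq // => i j /oppr_inj/eqP.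
    by rewrite eqr_nat eqSS => /eqP.
  have /allPn[y /mapP[i _ ->] Hy] := H.
  by exists (- i.+1%:R) => //; rewrite oppr_lt0.
have [gy0|gy0|/eqP] := ltgtP 0 g.[y]; last by rewrite eq_sym (negbTE gy).
  have [l [pl sl lP]] := cover_by_pairs y0 gy0 g0.
  by exists (pair_roots l); split=> //; exists l => //; left.
have [r /andP[yr rk] rr] : exists2 r, y <= r <= 0 & root g r.
  by apply: poly_ivt; [exact: ltW | rewrite (ltW gy0) (g0 0%N)].
have [g1 sg1 Dg] := divide_root rr nz.
have {}yr : y < r.
  rewrite lt_neqAle yr andbT; apply: contraTneq gy0 => ->.
  by rewrite (rootP rr) ltxx.
have rj (j : nat) : 0 < j.+1%:R - r by rewrite subr_gt0 (le_lt_trans rk).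
have [||k|l [pl sl lP]] := @cover_by_pairs (g1 \Po ('X + 1%:P)) (y - 1).
- by rewrite subr_lt0 (lt_le_trans y0).
- rewrite horner_comp_shift subrK.
  by move: gy0; rewrite Dg hornerM hornerXsubC nmulr_llt0 // subr_lt0.
- rewrite horner_comp_shift natr1.
  by have := g0 k.+1; rewrite Dg hornerM hornerXsubC pmulr_lge0.
exists (odd_roots l); split; first by exists l => //; right.
  by move: sl; rewrite size_comp_shift /= size_map sg1 ltnS.
case=> [//|k] gk; rewrite inE /= (mem_map succn_inj); apply: lP.
apply/eqP; rewrite horner_comp_shift natr1.
move: gk (rj k) => /eqP; rewrite Dg hornerM hornerXsubC mulf_eq0.
by case/orP=> [//|/eqP->]; rewrite ltxx.
Qed.

End Covering.

(** * The cone of polynomials that are non-negative on the natural numbers *)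

Lemma eventually_ge_lead_coef (p : {poly rat}) : 0 < lead_coef p ->
  exists M : nat, forall k : nat, (M <= k)%N -> lead_coef p <= p.[k%:R].
Proof.
move=> /poly_pinfty_gt_lc[x Hx]; exists (Num.bound `|x|) => k xk; apply: Hx.
apply: le_trans (ler_norm _) _; apply/ltW.
apply: lt_le_trans (archi_boundP (normr_ge0 _)) _.
by rewrite ler_nat.
Qed.

Lemma lead_coef_ge0 (p : {poly rat}) (M : nat) :
  (forall k : nat, (M <= k)%N -> 0 <= p.[k%:R]) -> 0 <= lead_coef p.
Proof.
move=> p0; rewrite leNgt; apply/negP => lp.
have [|M' HM] := @eventually_ge_lead_coef (- p).
  by rewrite lead_coefN oppr_gt0.
have := HM _ (leq_maxr M M'); have := p0 _ (leq_maxl M M').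
by rewrite lead_coefN hornerN; lra.
Qed.

Lemma eq_poly_nat (p q : {poly rat}) :
  (forall k : nat, p.[k%:R] = q.[k%:R]) -> p = q.
Proof.
move=> pq; apply/eqP; rewrite -subr_eq0; apply: contraT => nz.
have := @max_poly_roots _ (p - q) [seq i%:R | i <- iota 0 (size (p - q))] nz.
rewrite size_map size_iota ltnn; apply.
  by apply/allP => x /mapP[i _ ->]; rewrite /root hornerD hornerN pq subrr.
by rewrite map_inj_uniq ?iota_uniq // => i j /eqP; rewrite eqr_nat => /eqP.
Qed.

Lemma from_roots_dvd (p : {poly rat}) rs : uniq rs ->
  (forall k : nat, k \in rs -> p.[k%:R] = 0) ->
  exists u : {poly rat}, p = u * from_roots rat rs.
Proof.
move=> urs rp.
have : \prod_(x <- [seq k%:R | k <- rs]) ('X - x%:P) %| p.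
  apply: uniq_roots_dvdp.
    by apply/allP => x /mapP[k krs ->]; apply/rootP/rp.
  rewrite uniq_rootsE map_inj_uniq // => i j /eqP.
  by rewrite eqr_nat => /eqP.
by rewrite big_map => /dvdpP[u ->]; exists u.
Qed.

(** Both summands vanish at the simple roots of p, so x = u p and y = v p with u + v constant. Since
    p is eventually positive, u and v have non-negative leading coefficients; if u were not
    constant, these would be opposite, hence zero. *)
Lemma generator_extremal rs (x y : {poly rat}) (c : rat) : generator rs ->
  (forall k : nat, 0 <= x.[k%:R]) -> (forall k : nat, 0 <= y.[k%:R]) ->
  x + y = c *: from_roots rat rs ->
  exists2 c', 0 <= c' & x = c' *: from_roots rat rs.
Proof.
move=> grs x0 y0 xy; set p := from_roots rat rs in xy *.
have px k : k \in rs -> x.[k%:R] = 0 /\ y.[k%:R] = 0.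
  move=> krs; have : (x + y).[k%:R] = 0.
    move: krs; rewrite -(from_roots_eq0 rat) => /eqP pk.
    by rewrite xy hornerZ pk mulr0.
  by rewrite hornerD; have := x0 k; have := y0 k; split; lra.
have [u xu] := from_roots_dvd (generator_uniq grs) (fun k kr => (px k kr).1).
have [v yv] := from_roots_dvd (generator_uniq grs) (fun k kr => (px k kr).2).
have pm : p \is monic by exact: monic_from_roots.
have uv : u + v = c%:P.
  apply: (mulIf (monic_neq0 pm)); rewrite mulrDl -xu -yv xy.
  by rewrite mul_polyC.
have [|M HM] := @eventually_ge_lead_coef p; first by rewrite (monicP pm).
have ge0 w : (forall k : nat, 0 <= (w * p).[k%:R]) -> 0 <= lead_coef w.
  move=> wp; apply: (@lead_coef_ge0 _ M) => k /HM; rewrite (monicP pm) => p1.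
  by have := wp k; rewrite hornerM pmulr_lge0 // (lt_le_trans _ p1).
have lu : 0 <= lead_coef u by apply: ge0; rewrite -xu.
have lv : 0 <= lead_coef v by apply: ge0; rewrite -yv.
have su : (size u <= 1)%N.
  rewrite leqNgt; apply/negP => su.
  have Dv : v = c%:P - u by rewrite -uv addrAC subrr add0r.
  have lvu : lead_coef v = - lead_coef u.
    rewrite Dv addrC lead_coefDl ?lead_coefN // size_opp.
    exact: leq_ltn_trans (size_polyC_leq1 _) su.
  have /eqP : lead_coef u = 0 by lra.
  by rewrite lead_coef_eq0 => /eqP u0; rewrite u0 size_poly0 in su.
have Du : u = (u`_0)%:P by exact: size1_polyC.
exists u`_0; last by rewrite -mul_polyC -Du.
by move: lu; rewrite Du lead_coefC coefC.
Qed.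

(** Leading coefficients settle all k from some M on, and each of the finitely many smaller k
    imposes its own bound on e. The minimum works because lowering e preserves non-negativity. *)
Lemma dominates_multiple (g p : {poly rat}) :
  g != 0 -> (size p <= size g)%N ->
  (forall k : nat, 0 <= g.[k%:R]) -> (forall k : nat, 0 <= p.[k%:R]) ->
  (forall k : nat, g.[k%:R] = 0 -> p.[k%:R] = 0) ->
  exists2 e, 0 < e & forall k : nat, 0 <= (g - e *: p).[k%:R].
Proof.
move=> nz sp g0 p0 gp.
have lg : 0 < lead_coef g.
  by rewrite lt_def lead_coef_eq0 nz (@lead_coef_ge0 _ 0).
have lp : 0 <= lead_coef p by rewrite (@lead_coef_ge0 _ 0).
have dec (e e' : rat) k : e' <= e -> 0 <= (g - e *: p).[k%:R] ->
    0 <= (g - e' *: p).[k%:R].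
  by rewrite !hornerD !hornerN !hornerZ; have := p0 k; nra.
have [e1 e10 [M HM]] : exists2 e, 0 < e &
    exists M : nat, forall k : nat, (M <= k)%N -> 0 <= (g - e *: p).[k%:R].
  (* This makes e times the leading coefficient of p less than that of g; the summand 1 keeps the
     denominator positive even for p = 0. *)
  pose e := lead_coef g / (2 * (1 + lead_coef p)).
  have e0 : 0 < e by rewrite divr_gt0 // mulr_gt0 // ltr_pwDl.
  exists e => //.
  have lq : 0 < lead_coef (g - e *: p).
    have [spg|spg] := ltnP (size p) (size g).
      rewrite lead_coefDl ?size_opp ?(leq_ltn_trans (size_scale_leq _ _)) //.
    have {}spg : size p = size g by apply/eqP; rewrite eqn_leq sp.
    have cn : (g - e *: p)`_(size g).-1 = lead_coef g - e * lead_coef p.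
      by rewrite coefB coefZ /lead_coef spg.
    have cn0 : 0 < lead_coef g - e * lead_coef p.
      have : e * (2 * (1 + lead_coef p)) = lead_coef g.
        by rewrite divfK // mulf_neq0 // gt_eqF // ltr_pwDl.
      by nra.
    have sq : size (g - e *: p) = size g.
      apply/eqP; rewrite eqn_leq; apply/andP; split.
        rewrite (leq_trans (size_polyD _ _)) // geq_max leqnn size_opp.
        by rewrite (leq_trans (size_scale_leq _ _)) // spg.
      rewrite leqNgt; apply: contraL cn0 => sq.
      by rewrite -cn nth_default ?ltxx //; move: sq; case: (size g).
    by rewrite {1}/lead_coef sq cn.
  have [M HM] := eventually_ge_lead_coef lq.
  by exists M => k /HM; apply: le_trans; exact: ltW.
have [e2 e20 He2] : exists2 e, 0 < e &
    forall k : nat, (k < M)%N -> 0 <= (g - e *: p).[k%:R].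
  elim: M {HM} => [|M [e e0 He]]; first by exists 1.
  (* Where g vanishes so does p, and any positive value serves; elsewhere the summand 1 again guards
     against a zero denominator. *)
  pose e' := if g.[M%:R] == 0 then 1 else g.[M%:R] / (1 + p.[M%:R]).
  have e'0 : 0 < e'.
    rewrite /e'; case: eqVneq => // gM; rewrite divr_gt0 //.
      by rewrite lt_def gM g0.
    by rewrite ltr_pwDl.
  have He' : 0 <= (g - e' *: p).[M%:R].
    rewrite /e' hornerD hornerN hornerZ; case: eqVneq => [gM|gM].
      by rewrite gM gp // mulr0 subrr.
    rewrite mulrAC -[X in X - _]mulr1 -mulrA -mulrBr mulr_ge0 //.
    rewrite subr_ge0 ler_pdivrMr ?mul1r; first by rewrite lerDr.
    by rewrite ltr_pwDl.
  exists (Num.min e e'); first by rewrite lt_min e0.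
  move=> k; rewrite ltnS leq_eqVlt => /orP[/eqP->|kM].
    by apply: dec He'; rewrite ge_min lexx orbT.
  by apply: dec (He _ kM); rewrite ge_min lexx.
exists (Num.min e1 e2); first by rewrite lt_min e10.
move=> k; have [kM|kM] := ltnP k M.
  by apply: dec (He2 _ kM); rewrite ge_min lexx orbT.
by apply: dec (HM _ kM); rewrite ge_min lexx.
Qed.

Lemma generator_below (g : {poly rat}) :
  g != 0 -> (forall k : nat, 0 <= g.[k%:R]) ->
  exists rs, [/\ generator rs, (size rs < size g)%N & exists2 e, 0 < e &
    forall k : nat, 0 <= (g - e *: from_roots rat rs).[k%:R]].
Proof.
(* The covering relies on the intermediate value theorem, so g is moved to the real algebraic
   numbers; its zeros among the natural numbers stay the same. *)
move=> nz g0; set f := @ratr realalg.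
have E (k : nat) : (map_poly f g).[k%:R] = f g.[k%:R].
  by rewrite -(ratr_nat realalg k) /f horner_map.
have [||rs [grs srs Hrs]] := @cover_natural_roots _ (map_poly f g).
- by rewrite map_poly_eq0.
- by move=> k; rewrite E ler0q.
rewrite size_map_poly in srs.
exists rs; split=> //; apply: dominates_multiple => //.
- by rewrite size_from_roots.
- by move=> k; exact: generator_ge0.
move=> k gk; apply/eqP; rewrite from_roots_eq0 Hrs // E gk.
exact: rmorph0.
Qed.

(** * Finite differences and the polynomial description of [V n a] *)

Definition bin_poly (i : nat) : {poly rat} :=
  (i`!%:R)^-1 *: from_roots rat (iota 0 i).

Lemma size_bin_poly i : (size (bin_poly i) <= i.+1)%N.
Proof.
by rewrite (leq_trans (size_scale_leq _ _)) // size_from_roots size_iota.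
Qed.

Lemma horner_bin_poly i (k : nat) : (bin_poly i).[k%:R] = 'C(k, i)%:R.
Proof.
have f0 : i`!%:R != 0 :> rat by rewrite pnatr_eq0 -lt0n fact_gt0.
apply: (mulfI f0); rewrite hornerZ mulVKf // -natrM mulnC bin_ffact.
rewrite horner_from_roots; elim: i {f0} => [|i IH]; first by rewrite big_nil.
rewrite -addn1 iotaD big_cat IH big_seq1 add0n addn1 ffactnSr natrM.
have [ik|ki] := leqP i k; first by rewrite natrB.
by rewrite ffact_small //= !mul0r.
Qed.

(** The leading terms of p(x + 1) and p(x) cancel. *)
Lemma size_forward_difference (p : {poly rat}) n : (size p <= n.+1)%N ->
  (size (p \Po ('X + 1%:P) - p)%R <= n)%N.
Proof.
set q := p \Po _.
have sq : size q = size p by rewrite size_comp_poly2 // size_XaddC.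
move=> sp; apply/leq_sizeP => j nj; rewrite coefB.
have [sj|js] := leqP (size p) j; first by rewrite !nth_default ?sq ?subrr.
have Dj : j = (size p).-1 by lia.
rewrite {1}Dj -{1}sq Dj -!lead_coefE /q lead_coef_comp ?size_XaddC //.
by rewrite lead_coefXaddC expr1n mulr1 subrr.
Qed.

(** Multiplication of the power series by 1 - t; the value before index 0 counts as 0. *)
Definition back_diff (u : ratseq) : ratseq :=
  fun k => if k is k'.+1 then u k - u k' else u k.

(** A coefficient of a product depends only on initial segments, so a series may be replaced by a
    truncation and the ring laws of polynomials become available. *)
Lemma cauchy_prod_coefM (p w : {poly rat}) (h : ratseq) k :
  (forall i, (i <= k)%N -> w`_i = h i) ->
  cauchy_prod (coefs p) h k = (p * w)`_k.
Proof.
by move=> wh; rewrite coefM; apply: eq_bigr => i _; rewrite wh // leq_subr.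
Qed.

Definition diff_seq n (h : ratseq) : ratseq :=
  cauchy_prod (coefs ((1 - 'X) ^+ n)) h.

Lemma coef_trunc (h : ratseq) k i : (i <= k)%N ->
  (\poly_(i < k.+1) h i)`_i = h i.
Proof. by move=> ik; rewrite coef_poly ltnS ik. Qed.

Lemma diff_seq0 h : diff_seq 0 h = h.
Proof.
apply/funext => k; rewrite /diff_seq expr0.
by rewrite (cauchy_prod_coefM _ (@coef_trunc h k)) mul1r coef_trunc.
Qed.

Lemma diff_seqS n h : diff_seq n.+1 h = diff_seq n (back_diff h).
Proof.
apply/funext => k; rewrite /diff_seq exprSr.
rewrite (cauchy_prod_coefM _ (@coef_trunc h k)) -mulrA.
rewrite (@cauchy_prod_coefM _ ((1 - 'X) * \poly_(i < k.+1) h i)) // => i ik.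
rewrite mulrBl mul1r coefB coefXM; case: i ik => [|i] ik /=.
  by rewrite coef_trunc // subr0.
by rewrite !coef_trunc // ltnW.
Qed.

Lemma diff_seq_shift n m (h : ratseq) k :
  diff_seq n (fun j => if (j < m)%N then 0 else h (j - m)%N) (k + m) =
  diff_seq n h k.
Proof.
rewrite /diff_seq (cauchy_prod_coefM _ (@coef_trunc h k)).
rewrite (@cauchy_prod_coefM _ ('X^m * \poly_(i < k.+1) h i)).
  by rewrite mulrCA coefXnM ltnNge leq_addl /= addnK.
move=> i ik; rewrite coefXnM; case: ltnP => // mi.
by rewrite coef_trunc //; lia.
Qed.

(** Induction on n: summation builds a Newton expansion in binomial coefficients, and conversely a
    difference lowers the degree. The start moves from N to N + 1 because the difference at N would
    involve the value before N. *)
Lemma diff_seq_eventually0 n N (h : ratseq) :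
  (forall k, (N + n <= k)%N -> diff_seq n h k = 0) <->
  exists2 r : {poly rat}, (size r <= n)%N & forall i, h (N + i)%N = r.[i%:R].
Proof.
split=> [Dh|].
  suff [c Hc] : exists c : nat -> rat,
      forall i, h (N + i)%N = \sum_(j < n) c j * 'C(i, j)%:R.
    exists (\sum_(j < n) c j *: bin_poly j).
      apply: (leq_trans (size_sum _ _ _)); apply/bigmax_leqP => j _.
      rewrite (leq_trans (size_scale_leq _ _)) //.
      exact: leq_trans (size_bin_poly _) _.
    move=> i; rewrite Hc horner_sum; apply: eq_bigr => j _.
    by rewrite hornerZ horner_bin_poly.
  elim: n N h Dh => [|n IH] N h Dh.
    exists (fun=> 0) => i.
    by rewrite big_ord0 -[h]diff_seq0 Dh // addn0 leq_addr.
  have [|c Hc] := IH N.+1 (back_diff h).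
    by move=> k Nk; rewrite -diff_seqS Dh // addnS -addSn.
  (* The initial value becomes the constant term and, by Pascal's rule, the coefficients of the
     difference move up by one place. *)
  exists (fun j => if j is j'.+1 then c j' else h N).
  elim=> [|i IHi].
    rewrite addn0 big_ord_recl /= bin0 mulr1 big1 ?addr0 // => j _.
    by rewrite bin0n mulr0.
  have /= := Hc i; rewrite addnS => /(canRL (subrK _)) ->.
  rewrite IHi !big_ord_recl /= !bin0 addrCA -big_split /=; congr (_ + _).
  by apply: eq_bigr => j _; rewrite -mulrDr -natrD binS addnC.
elim: n N h => [|n IH] N h [r sr hr] k.
  rewrite addn0 => Nk; rewrite diff_seq0 -(subnKC Nk) hr.
  by move: sr; rewrite leqn0 size_poly_eq0 => /eqP->; rewrite horner0.
rewrite diff_seqS => Nk; apply: (IH N.+1); last by rewrite addSn -addnS.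
exists (r \Po ('X + 1%:P) - r); first exact: size_forward_difference.
move=> i; rewrite addSn /= -addnS !hr hornerD hornerN horner_comp hornerD.
by rewrite hornerX hornerC natr1.
Qed.

(* m is the number of zeros -1, ..., -m forced on the quasi-polynomial part of a
   sequence of V n a when a < -1; D is the number of its free coefficients. *)
Record dims (n : nat) (a : int) (H D m : nat) : Prop := Dims {
  dims_hat : hat a = H%:Z;
  dims_shift : hat a - a = m.+1%:Z;
  dims_size : (D + m)%N = n;
  dims_or : H = 0%N \/ m = 0%N }.

(** If a is at least -1, then H = a + 1 and m = 0; otherwise H = 0 and m = - a - 1, where the bound
    on a makes the truncated subtraction n - m exact. *)
Lemma dims_exist n (a : int) : - n%:Z <= a -> exists H D m, dims n a H D m.
Proof.
rewrite /hat => an; have [a1|a1] := lerP (- 1) a.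
  exists (absz (a + 1)), n, 0%N; split; rewrite ?addn0 //; last by right.
  - by rewrite /hat max_l; lia.
  - by rewrite /hat max_l; lia.
exists 0%N, (n - absz (- a - 1))%N, (absz (- a - 1)); split; last by left.
- by rewrite /hat max_r; lia.
- by rewrite /hat max_r; lia.
- lia.
Qed.

(** The rising product (j + 1) ... (j + m) is the falling factorial of j + m. Here j = H + i, and H
    is 0 unless the product is empty. *)
Lemma shift_prodE n a H D m i : dims n a H D m ->
  shift_prod a (H + i) = (from_roots rat (iota 0 m)).[(i + m)%:R].
Proof.
case=> _ sh _ Hm; rewrite /shift_prod sh absz_nat horner_from_roots.
have -> : iota 0 m = index_iota 0 m by rewrite /index_iota subn0.
rewrite big_add1 big_nat_rev /=; apply: eq_big_nat => k /andP[_ km].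
rewrite -natrB; last by lia.
by congr (_%:R); case: Hm km => -> ?; lia.
Qed.

Lemma shift_prod_gt0 a j : 0 < shift_prod a j.
Proof.
rewrite /shift_prod big_seq; apply: prodr_gt0 => k.
by rewrite mem_index_iota ltr0n => /andP[]; lia.
Qed.

(** Since a + n + 1 = H + D, membership says that (1 - t)^n h has no coefficient from H + D on.
    Multiplying h by t^m raises this bound to H + n, the form that [diff_seq_eventually0] handles;
    dividing out the m forced roots leaves q of size at most D. *)
Lemma V_P n a H D m h : dims n a H D m ->
  V n a h <-> exists2 q : {poly rat}, (size q <= D)%N &
    forall i, h (H + i)%N = q.[i%:R] * shift_prod a (H + i).
Proof.
move=> dim; have [hat_a sh Dm Hm] := dim.
have VE : V n a h <-> forall k, (H + D <= k)%N -> diff_seq n h k = 0.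
  split=> [[B sB /= BE] k kD|H0].
    rewrite /diff_seq BE /coefs nth_default // (leq_trans _ kD) // -lez_nat.
    by apply: le_trans sB _; lia.
  exists (\poly_(i < H + D) diff_seq n h i).
    apply: (@le_trans _ _ (H + D)%:Z); first by rewrite lez_nat size_poly.
    by lia.
  apply/funext => k; rewrite /coefs coef_poly.
  by case: ltnP => // /H0.
(* e is the coefficient sequence of t ^ m * h; its m leading zeros become roots
   of the polynomial that describes it from H on. *)
rewrite VE; pose e j := if (j < m)%N then 0 else h (j - m)%N.
have -> : (forall k, (H + D <= k)%N -> diff_seq n h k = 0) <->
          (forall k, (H + n <= k)%N -> diff_seq n e k = 0).
  split=> H0 k Hk.
    have -> : k = (k - m + m)%N by lia.
    by rewrite diff_seq_shift H0 //; lia.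
  by rewrite -(diff_seq_shift _ m) H0 //; lia.
have eh i : e (H + (i + m))%N = h (H + i)%N.
  by rewrite /e addnA ltnNge leq_addl /= addnK.
rewrite diff_seq_eventually0; split=> [[r sr er]|[q sq hq]].
  have rm i : (i < m)%N -> r.[i%:R] = 0.
    rewrite -er /e => im; case: Hm => Hm; first by rewrite Hm add0n im.
    by rewrite Hm in im.
  have [|k|q Dq] := @from_roots_dvd r (iota 0 m); first exact: iota_uniq.
    by rewrite mem_iota => /andP[_]; exact: rm.
  exists (q \Po ('X + m%:R%:P)).
    rewrite size_comp_poly2 ?size_XaddC //.
    have [->|nq] := eqVneq q 0; first by rewrite size_poly0.
    move: sr; rewrite Dq size_Mmonic ?monic_from_roots // size_from_roots.
    by rewrite size_iota addnS /= -Dm leq_add2r.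
  move=> i; rewrite -eh er Dq hornerM (shift_prodE _ dim) horner_comp.
  by rewrite hornerD hornerX hornerC -natrD.
exists ((q \Po ('X - m%:R%:P)) * from_roots rat (iota 0 m)).
  rewrite (leq_trans (size_polyMleq _ _)) // size_from_roots size_iota.
  by rewrite size_comp_poly2 ?size_XsubC // addnS /= -Dm leq_add2r.
move=> i; rewrite hornerM.
have [mi|im] := leqP m i.
  have -> : i = (i - m + m)%N by lia.
  rewrite eh hq (shift_prodE _ dim) horner_comp hornerXsubC.
  by rewrite natrD addrK.
have : (from_roots rat (iota 0 m)).[i%:R] == 0.
  by rewrite from_roots_eq0 mem_iota.
move=> /eqP->; rewrite mulr0 /e.
by case: Hm => Hm; [rewrite Hm add0n im | rewrite Hm in im].
Qed.

(** * [P n a] as the cone of non-negative sequences of [V n a] *)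

(** Each entry is a linear form in finitely many coordinates, hence continuous, so the set is an
    intersection of closed half-spaces. *)
Lemma closed_nonneg_coords d (f : {linear 'rV[rat^o]_d -> ratseq}) :
  closed [set v | forall j, 0 <= f v j].
Proof.
have -> : [set v | forall j, 0 <= f v j] =
    \bigcap_(j in [set: nat]) [set v | 0 <= f v j].
  by apply/seteqP; split=> [v H j _|v H j]; [exact: H|exact: (H j I)].
apply: closed_bigI => j _.
have fE v : f v j = \sum_i v 0 i * f (delta_mx 0 i) j :> rat^o.
  rewrite {1}[v]row_sum_delta linear_sum fct_sumE; apply: eq_bigr => i _.
  by rewrite linearZ.
have cf : continuous (fun v => f v j : rat^o).
  move=> v; have -> : (fun v => f v j : rat^o) =
      (fun v => \sum_i v 0 i * f (delta_mx 0 i) j : rat^o).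
    by apply/funext => w; exact: fE.
  have FF : Filter (nbhs v) by exact: nbhs_filter.
  apply: (@cvg_big rat^o _ _ _ _ _ _ (nbhs v)) => [|i _].
    exact: add_continuous.
  apply: (@cvgMr_tmp rat _ (nbhs v)).
  exact: (@coord_continuous rat 1 d 0 i v).
by have /continuous_closedP/(_ _ (@closed_ge rat 0)) := cf.
Qed.

(** The isomorphism that [euclidean_closed] asks for: H free values, then the D coefficients of q.
    The first summand needs no case distinction, as its coefficients are 0 from index H on. *)
Definition coord_seq (a : int) (H D : nat) (v : 'rV[rat^o]_(H + D)) : ratseq :=
  fun j => (rVpoly (lsubmx v))`_j + (if (H <= j)%N then
    (rVpoly (rsubmx v)).[(j - H)%:R] * shift_prod a j else 0).

Lemma coord_seq_linear a H D : linear (@coord_seq a H D).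
Proof.
move=> c u v; apply/funext => j.
transitivity (c * coord_seq a u j + coord_seq a v j); last by [].
rewrite /coord_seq !linearP /= coefD coefZ hornerD hornerZ.
case: leqP => _; last by rewrite !addr0.
by rewrite mulrDr mulrDl -mulrA addrACA.
Qed.

HB.instance Definition _ a H D :=
  GRing.isLinear.Build rat _ _ _ (@coord_seq a H D) (@coord_seq_linear a H D).

Lemma coord_seq_low a H D (v : 'rV_(H + D)) j : (j < H)%N ->
  coord_seq a v j = (rVpoly (lsubmx v))`_j.
Proof. by move=> jH; rewrite /coord_seq leqNgt jH addr0. Qed.

Lemma coord_seq_high a H D (v : 'rV_(H + D)) i :
  coord_seq a v (H + i) = (rVpoly (rsubmx v)).[i%:R] * shift_prod a (H + i).
Proof.
rewrite /coord_seq leq_addr addKn nth_default ?add0r //.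
by rewrite (leq_trans (size_poly _ _)) // leq_addr.
Qed.

Lemma coord_seq_bij n a H D m : dims n a H D m ->
  set_bij [set: 'rV[rat^o]_(H + D)] (V n a) (@coord_seq a H D).
Proof.
move=> dim; split.
- move=> v _; apply/(V_P _ dim); exists (rVpoly (rsubmx v)).
    exact: size_poly.
  exact: coord_seq_high.
- move=> u v _ _ uv; rewrite -[u]hsubmxK -[v]hsubmxK; congr row_mx.
    apply: (can_inj rVpolyK); apply/polyP => j.
    have [jH|Hj] := ltnP j H.
      by rewrite -!(@coord_seq_low a H D) // uv.
    by rewrite !nth_default // (leq_trans (size_poly _ _)).
  apply: (can_inj rVpolyK); apply: eq_poly_nat => i.
  apply: (mulIf (lt0r_neq0 (shift_prod_gt0 a (H + i)))).
  by rewrite -!(@coord_seq_high a H D) uv.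
move=> h /(V_P _ dim) [q sq hq].
exists (row_mx (poly_rV (\poly_(i < H) h i)) (poly_rV q)) => //.
apply/funext => j; have [jH|Hj] := ltnP j H.
  by rewrite coord_seq_low // row_mxKl poly_rV_K ?size_poly // coef_poly jH.
by rewrite -(subnKC Hj) coord_seq_high row_mxKr poly_rV_K ?hq.
Qed.

Lemma V_comb n a (x y : ratseq) (c e : rat) : - n%:Z <= a ->
  V n a x -> V n a y -> V n a (c *: x + e *: y).
Proof.
move=> /dims_exist[H [D [m dim]]] /(V_P _ dim)[p sp xp] /(V_P _ dim)[q sq yq].
apply/(V_P _ dim); exists (c *: p + e *: q).
  rewrite (leq_trans (size_polyD _ _)) // geq_max.
  by rewrite !(leq_trans (size_scale_leq _ _)).
move=> i; rewrite hornerD !hornerZ mulrDl -!mulrA -xp -yq.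
by [].
Qed.

Lemma convex_sub_combination (C : set ratseq) (x y : ratseq) (c : rat) :
  convex_set C -> 0 <= c -> c <= 1 -> C x -> C y -> C (c *: x + (1 - c) *: y).
Proof.
move=> cC c0 c1 Cx Cy.
by have := cC x y (Itv01 c0 c1) (mem_set Cx) (mem_set Cy); rewrite inE.
Qed.

(** The finitely many free values and the coefficients of q have a common denominator, and
    [shift_prod] takes integer values. *)
Lemma natural_multiple n a (h : ratseq) : - n%:Z <= a ->
  V n a h -> (forall j, 0 <= h j) ->
  exists2 N : nat, (0 < N)%N & natural_seqs (N%:R *: h).
Proof.
move=> /dims_exist[H [D [m dim]]] /(V_P _ dim)[q sq hq] h0.
pose int_val (x : rat) := exists z : int, x = z%:~R.
suff [N N0 HN] : exists2 N : nat, (0 < N)%N & forall j, int_val (N%:R * h j).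
  exists N => // j; have [z Ez] := HN j.
  exists (absz z); have -> : (N%:R *: h) j = N%:R * h j by [].
  have : 0 <= z by rewrite -(ler0z rat) -Ez mulr_ge0.
  by rewrite Ez; case: z {Ez}.
have int_valM x y : int_val x -> int_val y -> int_val (x * y).
  by move=> [u ->] [v ->]; exists (u * v); rewrite rmorphM.
have int_nat k : int_val k%:R by exists k%:Z.
have int_num x : int_val (`|denq x|%N%:R * x).
  exists (numq x).
  by rewrite numqE mulrC natr_absz gtr0_norm ?denq_gt0.
have [N1 N10 HN1] : exists2 N : nat, (0 < N)%N &
    forall j, (j < H)%N -> int_val (N%:R * h j).
  elim: (H) => [|k [N N0 HN]]; first by exists 1%N.
  exists (`|denq (h k)| * N)%N; first by rewrite muln_gt0 N0 absz_gt0 denq_eq0.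
  move=> j; rewrite ltnS leq_eqVlt => /orP[/eqP->|jk].
    by rewrite mulnC natrM -mulrA; apply: (int_valM).
  by rewrite natrM -mulrA; apply: (int_valM) => //; exact: HN.
have [p [c c0 Dq]] := rat_poly_scale q.
exists (N1 * `|c|)%N; first by rewrite muln_gt0 N10 absz_gt0.
move=> j; have [jH|Hj] := ltnP j H.
  by rewrite mulnC natrM -mulrA; apply: (int_valM) => //; exact: HN1.
rewrite natrM -mulrA; apply: (int_valM) => //.
rewrite -(subnKC Hj) hq Dq hornerZ mulrA mulrA.
apply: (int_valM); last first.
  by apply: (big_ind int_val) => //; exact: (int_nat 1%N).
apply: (int_valM).
  (* The absolute value of c divided by c is the sign of c. *)
  exists (sgz c); rewrite pmulrn abszEsg rmorphM /=.
  by rewrite mulfK // intr_eq0.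
by exists p.[(j - H)%:Z]; rewrite -horner_map.
Qed.

(** The non-negative sequences form a closed convex set containing the natural ones. Conversely, if
    N h is natural, h is the convex combination of N h and 0 with weight 1/N on N h. *)
Lemma P_P n a (h : ratseq) : - n%:Z <= a ->
  P n a h <-> V n a h /\ forall j, 0 <= h j.
Proof.
move=> an; split=> [Ph|[Vh h0] C [[cC _] SC]].
  apply: (Ph [set h | V n a h /\ forall j, 0 <= h j]); split; last first.
    by move=> g [Ng Vg]; split=> // j; have [k ->] := Ng j.
  split.
    move=> x y k; rewrite !inE => -[Vx x0] [Vy y0].
    have -> : conv k x y =
      k%:num%R *: (x : ratseq) + (1 - k%:num%R) *: (y : ratseq) by [].
    split; first exact: V_comb.
    by move=> j; apply: addr_ge0; apply: mulr_ge0; rewrite ?subr_ge0.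
  split; first by move=> g [].
  have [H [D [m dim]]] := dims_exist an.
  exists (H + D)%N, (@coord_seq a H D); split; first exact: coord_seq_bij dim.
  have -> : @coord_seq a H D @^-1` [set h | V n a h /\ forall j, 0 <= h j] =
     [set v | forall j, 0 <= @coord_seq a H D v j].
    apply/seteqP; split=> v /=; first by case.
    by split=> //; have [+ _ _] := coord_seq_bij dim; apply.
  exact: closed_nonneg_coords.
have [N N0 NN] := natural_multiple an Vh h0.
have Np : 0 < N%:R :> rat by rewrite ltr0n.
have -> : h = N%:R^-1 *: (N%:R *: h) + (1 - N%:R^-1) *: (0 : ratseq).
  by rewrite scaler0 addr0 scalerA mulVf ?gt_eqF // scale1r.
have V0 : V n a 0 by have := V_comb 0 0 an Vh Vh; rewrite scale0r addr0.
apply: convex_sub_combination => //.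

- by rewrite invf_le1 // ler1n.
- apply: SC; split=> //.
  by have := V_comb N%:R 0 an Vh V0; rewrite scaler0 addr0.
- by apply: SC; split=> // j; exists 0%N.
Qed.

Lemma P_comb n a (x y : ratseq) (c e : rat) : - n%:Z <= a ->
  0 <= c -> 0 <= e -> P n a x -> P n a y -> P n a (c *: x + e *: y).
Proof.
move=> an c0 e0 /(P_P _ an)[Vx x0] /(P_P _ an)[Vy y0].
apply/P_P => //; split; first exact: V_comb.
by move=> j; apply: addr_ge0; apply: mulr_ge0.
Qed.

(** * Rays, and the extreme rays of [P n a] *)

Lemma ray_eq (h g : ratseq) (c : rat) :
  g <> 0 -> 0 < c -> ray h (c *: g) -> ray h = ray g.
Proof.
move=> g0 c0 [d /= d0 dE].
have {}d0 : 0 < d.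
  rewrite lt_def d0 andbT; apply/eqP => dz; apply: g0.
  have := congr1 ( *:%R c^-1) dE.
  by rewrite dz scale0r scaler0 scalerA mulVf ?gt_eqF // scale1r.
have hE : h = (c / d) *: g.
  have := congr1 ( *:%R d^-1) dE.
  by rewrite !scalerA mulVf ?gt_eqF // scale1r mulrC.
have gE : g = (d / c) *: h.
  by rewrite hE scalerA mulrA divfK ?gt_eqF // divff ?gt_eqF // scale1r.
apply/seteqP; split=> x [e /= e0 <-].
  by exists (e * (c / d)); rewrite ?hE ?scalerA //= mulr_ge0 // divr_ge0 // ltW.
by exists (e * (d / c)); rewrite ?gE ?scalerA //= mulr_ge0 // divr_ge0 // ltW.
Qed.

Lemma extreme_rayI n a (h : ratseq) : - n%:Z <= a -> h <> 0 -> P n a h ->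
  (forall x y c, P n a x -> P n a y -> x + y = c *: h -> ray h x) ->
  extreme_ray (P n a) (ray h).
Proof.
move=> an h0 Ph H; split; first by exists h.
  move=> x [c /= c0 <-]; rewrite -[c *: h]addr0 -(scale0r h).
  exact: P_comb.
move=> x y Px Py [c /= c0 cE]; split; first by apply: (H x y c).
by apply: (H y x c) => //; rewrite addrC.
Qed.

(** Extremality applied to h = e g + (h - e g) puts e g on the ray of h. *)
Lemma extreme_ray_below n a (h g : ratseq) (e : rat) : g <> 0 -> 0 < e ->
  P n a (e *: g) -> P n a (h - e *: g) ->
  extreme_ray (P n a) (ray h) -> ray h = ray g.
Proof.
move=> g0 e0 Pg Phg [_ _ /(_ _ _ Pg Phg)]; rewrite addrC subrK => -[].
  by exists 1; rewrite ?scale1r //=.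
by move=> rg _; exact: ray_eq rg.
Qed.

Definition tail_seq (a : int) (H : nat) (q : {poly rat}) : ratseq := fun j =>
  if (H <= j)%N then q.[(j - H)%:R] * shift_prod a j else 0.

Lemma tail_seqE a H q i :
  tail_seq a H q (H + i) = q.[i%:R] * shift_prod a (H + i).
Proof. by rewrite /tail_seq leq_addr addKn. Qed.

Lemma tail_seq_low a H q j : (j < H)%N -> tail_seq a H q j = 0.
Proof. by rewrite /tail_seq ltnNge => /negbTE ->. Qed.

Lemma tail_seqD a H p q :
  tail_seq a H p + tail_seq a H q = tail_seq a H (p + q).
Proof.
apply/funext => j.
transitivity (tail_seq a H p j + tail_seq a H q j); first by [].
rewrite /tail_seq; case: leqP => _; last by rewrite addr0.
by rewrite hornerD mulrDl.
Qed.

Lemma tail_seqZ a H q (e : rat) :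
  e *: tail_seq a H q = tail_seq a H (e *: q).
Proof.
apply/funext => j.
transitivity (e * tail_seq a H q j); first by [].
rewrite /tail_seq; case: leqP => _; last by rewrite mulr0.
by rewrite hornerZ mulrA.
Qed.

Lemma tail_seq_inj a H : injective (tail_seq a H).
Proof.
move=> p q pq; apply: eq_poly_nat => i.
apply: (mulIf (lt0r_neq0 (shift_prod_gt0 a (H + i)))).
by rewrite -!tail_seqE pq.
Qed.

Lemma tail_seq_neq0 a H q : q != 0 -> tail_seq a H q <> 0.
Proof.
move=> /eqP q0 t0; apply: q0; apply: (@tail_seq_inj a H); rewrite t0.
apply/funext => j; rewrite /tail_seq horner0 mul0r.
by case: ifP.
Qed.

Section ConeP.
Context (n : nat) (a : int) (H D m : nat).
Context (an : - n%:Z <= a) (dim : dims n a H D m).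

Lemma P_tail_seq q : P n a (tail_seq a H q) <->
  (size q <= D)%N /\ forall k : nat, 0 <= q.[k%:R].
Proof.
split=> [/(P_P _ an)[/(V_P _ dim)[p sp pE] h0]|[sq q0]].
  have -> : q = p.
    apply: eq_poly_nat => i.
    apply: (mulIf (lt0r_neq0 (shift_prod_gt0 a (H + i)))).
    by rewrite -pE tail_seqE.
  split=> // k; have := h0 (H + k)%N.
  by rewrite pE pmulr_lge0 // shift_prod_gt0.
apply/(P_P _ an); split.
  by apply/(V_P _ dim); exists q => // i; rewrite tail_seqE.
move=> j; rewrite /tail_seq; case: leqP => // _.
by rewrite mulr_ge0 // ltW // shift_prod_gt0.
Qed.

Lemma tail_seqP h : P n a h -> (forall j, (j < H)%N -> h j = 0) ->
  exists q, h = tail_seq a H q.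
Proof.
move=> /(P_P _ an)[/(V_P _ dim)[q sq qE] _] h0; exists q.
apply/funext => j; have [jH|Hj] := ltnP j H.
  by rewrite h0 // tail_seq_low.
by rewrite -(subnKC Hj) qE tail_seqE.
Qed.

Lemma monomial_seq_neq0 i : monomial_seq i <> 0.
Proof.
move=> /(congr1 (fun h : ratseq => h i)); rewrite /monomial_seq eqxx.
by move/eqP; rewrite oner_eq0.
Qed.

(** Changing one of the H free values leaves the polynomial q untouched. *)
Lemma P_sub_monomial_seq h i (c : rat) : (i < H)%N -> c <= h i ->
  P n a h -> P n a (h - c *: monomial_seq i).
Proof.
move=> iH ci /(P_P _ an)[Vh h0].
have hE j : (h - c *: monomial_seq i) j = h j - c * (j == i)%:R by [].
apply/(P_P _ an); split.
  have [q sq qE] := (V_P _ dim).1 Vh; apply/(V_P _ dim); exists q => // k.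
  by rewrite hE gtn_eqF ?mulr0 ?subr0 // ltn_addr.
move=> j; rewrite hE; have [->|_] := eqVneq j i.
  by rewrite mulr1 subr_ge0.
by rewrite mulr0 subr0.
Qed.

Lemma P0 : P n a 0.
Proof.
have -> : (0 : ratseq) = tail_seq a H 0.
  by apply/funext => j; rewrite /tail_seq horner0 mul0r if_same.
by apply/P_tail_seq; split=> [|k]; rewrite ?size_poly0 ?horner0.
Qed.

Lemma P_monomial_seq i (c : rat) : (i < H)%N -> 0 <= c ->
  P n a (c *: monomial_seq i).
Proof.
move=> iH c0; have := @P_sub_monomial_seq 0 i (- c) iH _ P0.
by rewrite scaleNr opprK add0r; apply; rewrite oppr_le0.
Qed.

Lemma summand_eq0 (x y z : ratseq) j : P n a x -> P n a y -> x + y = z ->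
  z j = 0 -> x j = 0.
Proof.
move=> /(P_P _ an)[_ x0] /(P_P _ an)[_ y0] <-.
have -> : (x + y) j = x j + y j by [].
by move/eqP; rewrite paddr_eq0 // => /andP[/eqP].
Qed.

Lemma extreme_monomial_seq i : (i < H)%N ->
  extreme_ray (P n a) (ray (monomial_seq i)).
Proof.
move=> iH; apply: extreme_rayI => //.
- exact: monomial_seq_neq0.
- by rewrite -[monomial_seq i]scale1r; exact: P_monomial_seq.
move=> x y c Px Py xy; exists (x i).
  exact: ((P_P _ an).1 Px).2.
apply/funext => j.
transitivity (x i * (j == i)%:R); first by [].
have [->|ji] := eqVneq j i; first by rewrite mulr1.
rewrite mulr0; apply/esym/(summand_eq0 Px Py xy).
transitivity (c * (j == i)%:R); first by [].
by rewrite (negbTE ji) mulr0.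
Qed.

Lemma extreme_generator rs : generator rs -> (size rs < D)%N ->
  extreme_ray (P n a) (ray (tail_seq a H (from_roots rat rs))).
Proof.
move=> grs srs; apply: extreme_rayI => //.
- by apply: tail_seq_neq0; rewrite monic_neq0 ?monic_from_roots.
- apply/P_tail_seq; rewrite size_from_roots; split=> // k.
  exact: generator_ge0.
move=> x y c Px Py xy.
(* Non-negative summands vanish wherever their sum does, in particular on the first H entries, so
   both come from polynomials. *)
have low z w : P n a z -> P n a w ->
    z + w = c *: tail_seq a H (from_roots rat rs) ->
    exists q, z = tail_seq a H q.
  move=> Pz Pw zw; apply: tail_seqP => // j jH.
  by apply: (summand_eq0 Pz Pw zw); rewrite tail_seqZ tail_seq_low.
have [p xE] := low _ _ Px Py xy.
have [q yE] := low _ _ Py Px (etrans (addrC _ _) xy).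
rewrite xE yE in Px Py xy *.
have [_ p0] := (P_tail_seq _).1 Px; have [_ q0] := (P_tail_seq _).1 Py.
have [|c' c'0 ->] := @generator_extremal rs p q c grs p0 q0.
  apply: (@tail_seq_inj a H); rewrite -tail_seqZ -xy.
  by rewrite tail_seqD.
by exists c' => //; rewrite tail_seqZ.
Qed.

(** For the forward direction, a nonzero free value of h lets a multiple of a monomial be subtracted
    within the cone; if all free values are zero, [generator_below] supplies a generator to
    subtract. In either case [extreme_ray_below] identifies the rays. *)
Lemma extreme_rayE R : extreme_ray (P n a) R <->
  (exists2 i, (i < H)%N & R = ray (monomial_seq i)) \/
  (exists2 rs, generator rs /\ (size rs < D)%N &
     R = ray (tail_seq a H (from_roots rat rs))).
Proof.
split; last first.
  move=> [[i iH ->]|[rs [grs srs] ->]]; first exact: extreme_monomial_seq.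
  exact: extreme_generator.
move=> exR; have [[h h0 RE] RP _] := exR; rewrite RE in exR *.
have Ph : P n a h by apply: RP; rewrite RE; exists 1; rewrite ?scale1r //=.
have [[i [iH hi]]|low] := pselect (exists i, (i < H)%N /\ h i <> 0).
  left; exists i => //.
  have hi0 : 0 < h i.
    by rewrite lt_def; have [_ ->] := (P_P _ an).1 Ph; rewrite andbT; apply/eqP.
  apply: (@extreme_ray_below n a h (monomial_seq i) (h i)) => //.
  - exact: monomial_seq_neq0.
  - by apply: P_monomial_seq => //; exact: ltW.
  - exact: P_sub_monomial_seq.
have [|q hE] := tail_seqP Ph.
  by move=> j jH; apply: contrapT => hj; apply: low; exists j.
rewrite hE in h0 Ph exR *; have [sq q0] := (P_tail_seq _).1 Ph.
have qn0 : q != 0.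
  apply/eqP => qz; apply: h0; rewrite qz.
  by apply/funext => j; rewrite /tail_seq horner0 mul0r if_same.
have [rs [grs srs [e e0 qe]]] := generator_below qn0 q0.
right; exists rs; first by split=> //; exact: leq_trans sq.
have Pe : P n a (tail_seq a H (e *: from_roots rat rs)).
  apply/P_tail_seq; split=> [|k].
    rewrite (leq_trans (size_scale_leq _ _)) // size_from_roots.
    exact: leq_trans srs sq.
  by rewrite hornerZ mulr_ge0 ?(ltW e0) ?generator_ge0.
apply: (@extreme_ray_below n a _ _ e) => //.
- by apply: tail_seq_neq0; rewrite monic_neq0 ?monic_from_roots.
- by rewrite tail_seqZ.
rewrite -scaleNr tail_seqZ tail_seqD scaleNr; apply/P_tail_seq; split=> //.
rewrite (leq_trans (size_polyD _ _)) // geq_max sq size_opp.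
by have [] := (P_tail_seq _).1 Pe.
Qed.

End ConeP.

(** * Translation to the families of the theorem *)

Lemma lambda_seqE a H l : hat a = H%:Z ->
  lambda_seq a l = tail_seq a H (from_roots rat (pair_roots l)).
Proof.
move=> aH; apply/funext => j; rewrite /lambda_seq /tail_seq aH lez_nat.
case: leqP => // Hj; rewrite subzn // part_polyE !horner_from_roots.
rewrite rmorph_prod; congr (_ * _); apply: eq_bigr => i _.
by rewrite rmorphB /= !mulrz_nat.
Qed.

Lemma mu_seqE a H l : hat a = H%:Z ->
  mu_seq a l = tail_seq a H (from_roots rat (odd_roots l)).
Proof.
move=> aH; apply/funext => j; rewrite /mu_seq /tail_seq aH lez_nat.
case: leqP => // Hj; rewrite subzn // part_polyE !horner_from_roots.
rewrite rmorphM rmorph_prod big_cons big_map subr0 /=; congr (_ * _ * _).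
apply: eq_bigr => i _.
rewrite !rmorphB /= !mulrz_nat -natr1 opprD.
by rewrite [- _ - 1]addrC addrA.
Qed.

Theorem proposition3p2 (n : nat) (a : int) (a_ge : - n%:Z <= a) :
  [set R | extreme_ray (P n a) R] =
    [set ray (monomial_seq i) | i in [set i : nat | i%:Z <= a]]
    `|` [set ray (lambda_seq a l) | l in
          [set l : seq nat | is_partition l /\
             (size l)%:Z <= ((n%:Z - hat a + a) %/ 2)%Z]]
    `|` [set ray (mu_seq a m) | m in
          [set m : seq nat | is_partition m /\
             (size m)%:Z <= ((n%:Z - hat a + a - 1) %/ 2)%Z]].
Proof.
have [H [D [m dim]]] := dims_exist a_ge.
have [aH sh Dm Hm] := dim.
(* Here n - [hat a] + a = D - 1, so the bounds on the number of parts say that the number of roots,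
   2r or 2r + 1 for r parts, is less than D. *)
have even_size l : ((size l)%:Z <= ((n%:Z - hat a + a) %/ 2)%Z) =
    (size (pair_roots l) < D)%N.
  by rewrite size_pair_roots lez_divRL //; lia.
have odd_size l : ((size l)%:Z <= ((n%:Z - hat a + a - 1) %/ 2)%Z) =
    (size (odd_roots l) < D)%N.
  by rewrite /= size_map size_pair_roots lez_divRL //; lia.
(* Either m = 0 and a = H - 1, or H = 0 and a is negative. *)
have mono i : (i%:Z <= a) = (i < H)%N by lia.
apply/seteqP; split=> R /=.
  move=> /(extreme_rayE a_ge dim)[[i iH ->]|[rs [[l pl rsE] srs] ->]].
    by left; left; exists i => //=; rewrite mono.
  case: rsE => rsE; rewrite rsE in srs *.
    left; right; exists l; first by rewrite /= even_size.
    by rewrite (lambda_seqE _ aH).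
  right; exists l; first by rewrite /= odd_size.
  by rewrite (mu_seqE _ aH).
move=> RE; apply/(extreme_rayE a_ge dim).
case: RE => [[[i /= ia <-]|[l /= [pl sl] <-]]|[l /= [pl sl] <-]].
- by left; exists i => //; rewrite -mono.
- right; exists (pair_roots l); last by rewrite (lambda_seqE _ aH).
  by split; [exists l => //; left | rewrite -even_size].
- right; exists (odd_roots l); last by rewrite (mu_seqE _ aH).
  by split; [exists l => //; right | rewrite -odd_size].
Qed.
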